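(* Let $c_0$ be a proper $4$-colouring of the plane, let $\mu$ be a left-invariant finitely additive probability measure on $S_4\times E(2)$, and let $p_d$ be the associated monochromaticity probabilities (see context). Then for real $d$: (1) if $\frac12\le d\le\sqrt{\frac12(2-\sqrt2)(3-\sqrt3)}$, then $p_d\ge\frac1{150}$; (2) if $\sqrt{\frac12(2-\sqrt2)(3-\sqrt3)}<d\le\sqrt{\frac{19}{15}-\frac2{\sqrt5}}$, then $p_d\ge\frac{14}{2325}$; (3) if $\sqrt{\frac{19}{15}-\frac2{\sqrt5}}<d\le\frac12\sqrt{5-2\sqrt3}$, then $p_d\ge\frac1{300}$; (4) if $\frac12\sqrt{5+2\sqrt3}\le d<\sqrt{\frac{19}{15}+\frac2{\sqrt5}}$, then $p_d\ge\frac1{300}$; (5) if $\sqrt{\frac{19}{15}+\frac2{\sqrt5}}\le d<\sqrt{\frac12(2+\sqrt2)(3-\sqrt3)}$, then $p_d\ge\frac{14}{2325}$; (6) if $\sqrt{\frac12(2+\sqrt2)(3-\sqrt3)}\le d$, then $p_d\ge\frac1{150}$.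
   Context: Identify the plane with $\mathbb C$. A proper $4$-colouring of the plane is a map $c_0:\mathbb C\to\{1,2,3,4\}$ such that no two points at distance $1$ have the same colour. Let $S_4$ be the group of permutations of the colours and $E(2)$ the group of Euclidean isometries of the plane. The group $S_4\times E(2)$ is amenable, so there is a finitely additive probability measure $\mu$ defined on all subsets of $S_4\times E(2)$ which is left-invariant, i.e. $\mu(gE)=\mu(E)$ for all $g\in S_4\times E(2)$ and $E\subseteq S_4\times E(2)$. For $(\sigma,T)\in S_4\times E(2)$ consider the (random) colouring $c=\sigma\circ c_0\circ T^{-1}$. For $d\ge 0$, $p_d$ denotes the probability that two points $A,B$ at distance $d$ get the same colour: $p_d=\mu(\{(\sigma,T): c(A)=c(B)\})$; by left-invariance this does not depend on the choice of $A,B$ with $|AB|=d$. The existence of $c_0$ is a standing assumption, and $c_0,\mu$ are arbitrary but fixed. *)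

(* Defs.v *)
From HB Require Import structures.
From mathcomp Require Import all_boot all_order all_algebra all_fingroup.
From mathcomp Require Import boolp classical_sets reals.
From mathcomp Require Import complex.

Set Implicit Arguments.
Unset Strict Implicit.
Unset Printing Implicit Defensive.

Import Order.TTheory GRing.Theory Num.Theory.
Local Open Scope ring_scope.
Local Open Scope complex_scope.
Local Open Scope classical_set_scope.

(* The plane is R[i]. The norm of R[i] takes its values in R[i], so that
   "|AB| = d" for a real d reads `|A - B| = d%:C. *)

Definition proper_coloring (R : realType) (c0 : R[i] -> 'I_4) : Prop :=
  forall x y : R[i], `|x - y| = 1 -> c0 x <> c0 y.

(* The group E(2): isometries of the plane, given with their inverse. *)
Record isometry (R : realType) := Isometry {
  iso_fun :> R[i] -> R[i];
  iso_inv : R[i] -> R[i];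
  iso_funK : cancel iso_fun iso_inv;
  iso_invK : cancel iso_inv iso_fun;
  iso_norm : forall x y : R[i], `|iso_fun x - iso_fun y| = `|x - y| }.

Section IsometryComposition.
Variables (R : realType) (S T : isometry R).

Lemma iso_comp_norm (x y : R[i]) : `|(S \o T) x - (S \o T) y| = `|x - y|.
Proof. by rewrite /= !iso_norm. Qed.

Definition iso_comp : isometry R :=
  Isometry (can_comp (@iso_funK R S) (@iso_funK R T))
           (can_comp (@iso_invK R T) (@iso_invK R S))
           iso_comp_norm.

End IsometryComposition.

Definition colsym (R : realType) : Type := ('S_4 * isometry R)%type.

(* The group law is composition of maps in both factors. Since permM reads
   (s * t)%g x = t (s x), the permutation "s after t" is (t * s)%g. *)
Definition colsym_mul (R : realType) (g h : colsym R) : colsym R :=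
  ((h.1 * g.1)%g, iso_comp g.2 h.2).

Record left_invariant_prob (R : realType) (mu : set (colsym R) -> R) : Prop := {
  prob_ge0 : forall E, 0 <= mu E;
  prob_setT : mu setT = 1;
  prob_additive : forall E F, E `&` F = set0 -> mu (E `|` F) = mu E + mu F;
  prob_left_invariant : forall g E, mu (colsym_mul g @` E) = mu E }.

Definition coloring_of (R : realType) (c0 : R[i] -> 'I_4) (g : colsym R)
  (z : R[i]) : 'I_4 := g.1 (c0 (iso_inv g.2 z)).

Definition same_color_prob (R : realType) (c0 : R[i] -> 'I_4)
    (mu : set (colsym R) -> R) (A B : R[i]) : R :=
  mu [set g | coloring_of c0 g A = coloring_of c0 g B].

(* The number p_d, computed on the points 0 and d; mono_probE shows that any
   two points at distance d give the same value. *)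
Definition mono_prob (R : realType) (c0 : R[i] -> 'I_4)
    (mu : set (colsym R) -> R) (d : R) : R :=
  same_color_prob c0 mu 0 d%:C.

Section MonoProbE.
Variable R : realType.
Implicit Types (S T : isometry R) (A B : R[i]).

Lemma isometry_eq S T : iso_fun S =1 iso_fun T -> S = T.
Proof.
case: S T => [f f' fK f'K fN] [g g' gK g'K gN] /= /funext fg.
subst g; have f'g' : f' = g'.
  by apply/funext => x; rewrite -{1}(g'K x) fK.
by subst g'; congr Isometry; exact: Prop_irrelevance.
Qed.

Lemma iso_inv_norm T A B : `|iso_inv T A - iso_inv T B| = `|A - B|.
Proof. by rewrite -(iso_norm T) !iso_invK. Qed.

Definition iso_sym T : isometry R :=
  Isometry (@iso_invK R T) (@iso_funK R T) (@iso_inv_norm T).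

Lemma affineK (u a : R[i]) : u != 0 ->
  cancel (fun z => u * z + a) (fun z => u^-1 * (z - a)).
Proof. by move=> u0 z; rewrite addrK mulKf. Qed.

Lemma affineVK (u a : R[i]) : u != 0 ->
  cancel (fun z => u^-1 * (z - a)) (fun z => u * z + a).
Proof. by move=> u0 z; rewrite mulVKf // subrK. Qed.

Lemma affine_norm (u a : R[i]) : `|u| = 1 ->
  forall x y : R[i], `|u * x + a - (u * y + a)| = `|x - y|.
Proof. by move=> u1 x y; rewrite opprD addrACA subrr addr0 -mulrBr normrM u1 mul1r. Qed.

Lemma isometry_exists A B (d : R) : `|A - B| = d%:C ->
  exists S, S 0 = A /\ S d%:C = B.
Proof.
move=> ABd.
have affine u a : `|u| = 1 -> exists S : isometry R, forall z, S z = u * z + a.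
  move=> u1; have u0 : u != 0 by rewrite -normr_eq0 u1 oner_eq0.
  by exists (Isometry (affineK a u0) (affineVK a u0) (affine_norm a u1)).
have [AB|AB] := eqVneq A B.
  move: ABd; rewrite AB subrr normr0 => <-.
  have [S SE] := affine 1 B (normr1 _).
  by exists S; rewrite SE mulr0 add0r.
have d0 : d%:C != 0 by rewrite -ABd normr_eq0 subr_eq0.
have [|S SE] := affine ((B - A) / d%:C) A.
  rewrite normrM normfV distrC ABd ger0_norm ?mulfV //.
  by rewrite -ABd.
by exists S; rewrite !SE mulr0 add0r divfK // subrK.
Qed.

Lemma mono_probE (c0 : R[i] -> 'I_4) (mu : set (colsym R) -> R) A B (d : R) :
  left_invariant_prob mu -> `|A - B| = d%:C ->
  same_color_prob c0 mu A B = mono_prob c0 mu d.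
Proof.
move=> muP /isometry_exists[S [<- <-]].
pose g : colsym R := (1%g, S).
rewrite /mono_prob /same_color_prob -[RHS](prob_left_invariant muP g).
congr mu; apply/seteqP; split=> [[s T] /= ST|_ [[s T] /= ST <-]].
  exists (s, iso_comp (iso_sym S) T).
    by move: ST; rewrite /coloring_of.
  rewrite /colsym_mul /= mulg1; congr pair.
  by apply: isometry_eq => z /=; rewrite iso_invK.
by move: ST; rewrite /coloring_of /= mulg1 !iso_funK.
Qed.

End MonoProbE.

(* Main.v *)
Require Import Defs.
From HB Require Import structures.
From mathcomp Require Import all_boot all_order all_algebra all_fingroup.
From mathcomp Require Import boolp classical_sets reals.
From mathcomp Require Import complex.
From mathcomp Require Import ring lra.

(* For [e >= 1/2], two points of the circle of radius [e] around [O] are at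
   distance 1, so at most one of them shares the colour of [O]: [p e <= 1/2].
   If [p e] were close to 1/2, then of any two such points exactly one would
   almost surely share the colour of [O], so that points [C], [C'] of the
   circle with a common unit neighbour on it would share the colour of [O]
   simultaneously. Hence along a zigzag path with edges of length [e], all five
   vertices have the same colour with probability close to 1/2, and otherwise
   two of them still do by the pigeonhole principle; this is too many
   monochromatic pairs, and gives upper bounds on [p e] below 1/2.
   Finally, a five-point configuration whose distances are 1, [d] (five times)
   and two others [e], [e'] gives [5 p d >= 1 - p e - p e']. *)

Set Implicit Arguments.
Unset Strict Implicit.
Unset Printing Implicit Defensive.

Import Order.TTheory GRing.Theory Num.Theory.
Local Open Scope ring_scope.
Local Open Scope complex_scope.
Local Open Scope classical_set_scope.

(** * Square roots and distances in coordinates *)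

Lemma le_of_sqr (R : realType) (x y : R) : 0 <= y -> x ^+ 2 <= y ^+ 2 -> x <= y.
Proof. by move=> y0 xy; rewrite leNgt; apply/negP => yx; nra. Qed.

Lemma half_sqrt (R : rcfType) (x : R) :
  0 <= x -> 1 / 2 * Num.sqrt x = Num.sqrt (x / 4).
Proof.
move=> x0; have h0 : 0 <= 1 / 2 * Num.sqrt x by rewrite mulr_ge0 ?sqrtr_ge0; lra.
apply/eqP; rewrite -(@eqrXn2 _ 2) ?sqrtr_ge0 //; apply/eqP.
by rewrite exprMn !sqr_sqrtr; lra.
Qed.

Lemma half_le_sqrt (R : rcfType) (z : R) : 1 / 2 <= Num.sqrt (1 / 4 + z ^+ 2).
Proof.
have z2 := sqr_ge0 z; rewrite -ler_sqr ?nnegrE ?sqrtr_ge0 //; last lra.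
by rewrite sqr_sqrtr; lra.
Qed.

Lemma normc_dist (R : realType) (x1 y1 x2 y2 d : R) :
  0 <= d -> (x1 - x2) ^+ 2 + (y1 - y2) ^+ 2 = d ^+ 2 ->
  `|(x1 +i* y1) - (x2 +i* y2)| = d%:C.
Proof. by move=> d0 E; rewrite normc_def /= E sqrtr_sqr ger0_norm. Qed.

(** * Finitely additive probability for finite-valued observations *)

Section FiniteProbability.
Variables (R : realType) (mu : set (colsym R) -> R).
Hypothesis muP : left_invariant_prob mu.

Lemma prob_set0 : mu set0 = 0.
Proof.
have := prob_additive muP (set0I (set0 : set (colsym R))).
by rewrite setU0 => /eqP; rewrite -subr_eq0 opprD addNKr oppr_eq0 => /eqP.
Qed.

Lemma prob_true : mu [set _ | true] = 1.
Proof. by rewrite -(prob_setT muP); congr mu; apply/seteqP. Qed.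

Lemma prob_finite_valued (T : finType) (X : colsym R -> T) (Q : pred T) :
  mu [set g | Q (X g)] = \sum_(t | Q t) mu [set g | X g = t].
Proof.
rewrite -big_enum /=; have: uniq (enum Q) := enum_uniq Q.
have -> : [set g | Q (X g)] = [set g | X g \in enum Q].
  by apply/seteqP; split=> g /=; rewrite mem_enum.
elim: (enum Q) => [|t s IHs] /=.
  move=> _; rewrite big_nil -prob_set0; congr mu.
  by apply/seteqP; split=> g /=; rewrite ?in_nil.
case/andP=> ts us; rewrite big_cons -IHs // -(prob_additive muP).
  congr mu; apply/seteqP; split=> g /=; rewrite in_cons.
    by case/orP=> [/eqP|]; [left|right].
  by case=> [->|->]; rewrite ?eqxx ?orbT.
apply/seteqP; split=> g //= [gt gs].
by rewrite -gt gs in ts.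
Qed.

(** Both sides are expectations of integer-valued functions of [X], so a pointwise inequality passes
    to them. *)
Lemma prob_weighted_le (T : finType) (X : colsym R -> T)
    (r s : seq (nat * (T -> bool))) :
  (forall t, \sum_(a <- r) a.1 * a.2 t <= \sum_(b <- s) b.1 * b.2 t)%N ->
  \sum_(a <- r) a.1%:R * mu [set g | a.2 (X g)]
    <= \sum_(b <- s) b.1%:R * mu [set g | b.2 (X g)].
Proof.
move=> rs.
have expand (u : seq (nat * (T -> bool))) :
    \sum_(a <- u) a.1%:R * mu [set g | a.2 (X g)] =
    \sum_t (\sum_(a <- u) a.1 * a.2 t)%N%:R * mu [set g | X g = t].
  transitivity (\sum_(a <- u) \sum_t
      (a.1 * a.2 t)%N%:R * mu [set g | X g = t]).
    apply: eq_bigr => a _; rewrite prob_finite_valued mulr_sumr big_mkcond.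
    apply: eq_bigr => t _ /=.
    by rewrite natrM; case: (a.2 t); rewrite ?mulr1 ?mulr0 ?mul0r.
  rewrite exchange_big; apply: eq_bigr => t _ /=.
  by rewrite natr_sum mulr_suml.
rewrite !expand; apply: ler_sum => t _.
by rewrite ler_wpM2r ?ler_nat ?rs // (prob_ge0 muP).
Qed.

End FiniteProbability.

(** * Enumeration of colour words *)

Fixpoint words (k n : nat) : seq (seq nat) :=
  if n is n'.+1 then [seq a :: w | a <- iota 0 k, w <- words k n'] else [:: [::]].

Lemma words_complete k n (t : n.-tuple 'I_k) : [seq val x | x <- t] \in words k n.
Proof.
elim: n t => [|n IHn] t; first by rewrite tuple0.
case/tupleP: t => x t; apply: allpairs_f; last exact: IHn.
by rewrite mem_iota ltn_ord.
Qed.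

Definition same_at (i j : nat) (w : seq nat) : bool := nth 0%N w i == nth 0%N w j.
Arguments same_at : simpl never.

(** Written with [sumn] on words of plain naturals, so that [vm_compute] can check all words. *)
Definition total_weight (r : seq (nat * (seq nat -> bool))) (w : seq nat) : nat :=
  sumn [seq (a.1 * a.2 w)%N | a : nat * (seq nat -> bool) <- r].

(** * Monochromatic pairs in finite configurations *)

Section ColoringProbabilities.
Variables (R : realType) (c0 : R[i] -> 'I_4) (mu : set (colsym R) -> R).
Hypotheses (c0P : proper_coloring c0) (muP : left_invariant_prob mu).
Local Notation p := (mono_prob c0 mu).

Definition color_word (P : seq R[i]) (g : colsym R) : seq nat :=
  [seq val (coloring_of c0 g A) | A <- P].
Arguments color_word : simpl never.

Definition switch_prob (A B C : R[i]) : R :=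
  mu [set g | coloring_of c0 g A = coloring_of c0 g B
              /\ coloring_of c0 g A <> coloring_of c0 g C].

Lemma color_word_weighted_le (P : seq R[i]) (r s : seq (nat * (seq nat -> bool))) :
  all (fun w => total_weight r w <= total_weight s w)%N (words 4 (size P)) ->
  \sum_(a <- r) a.1%:R * mu [set g | a.2 (color_word P g)]
    <= \sum_(b <- s) b.1%:R * mu [set g | b.2 (color_word P g)].
Proof.
move=> /allP rs; pose T : finType := ((size P).-tuple 'I_4)%type.
pose X g : T := map_tuple (coloring_of c0 g) (in_tuple P).
pose lift (a : nat * (seq nat -> bool)) : nat * (T -> bool) :=
  (a.1, fun t : T => a.2 [seq val x | x <- t]).
have wX g : [seq val x | x <- X g] = color_word P g by rewrite -map_comp.
have liftE u : \sum_(a <- map lift u) a.1%:R * mu [set g | a.2 (X g)] =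
    \sum_(a <- u) a.1%:R * mu [set g | a.2 (color_word P g)].
  rewrite big_map; apply: eq_bigr => a _ /=; congr (_ * mu _).
  by apply/funext => g; rewrite /= wX.
have := @prob_weighted_le _ _ muP _ X (map lift r) (map lift s).
rewrite !liftE; apply=> t; have := rs _ (words_complete t).
by rewrite /total_weight !sumnE !big_map.
Qed.

Lemma same_atE (P : seq R[i]) i j : (i < size P)%N -> (j < size P)%N ->
  mu [set g | same_at i j (color_word P g)] = same_color_prob c0 mu P`_i P`_j.
Proof.
move=> iP jP; congr mu; apply/seteqP.
split=> g /=; rewrite /same_at !(nth_map 0) //; first by move=> /eqP/val_inj.
by move=> ->.
Qed.

Lemma mono_prob1 : p 1 = 0.
Proof.
rewrite /mono_prob /same_color_prob -[RHS](prob_set0 muP); congr mu.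
apply/seteqP; split=> g //= /perm_inj; apply: c0P.
by rewrite iso_inv_norm sub0r normrN normr1.
Qed.

Lemma switch_atE (P : seq R[i]) i j k :
    (i < size P)%N -> (j < size P)%N -> (k < size P)%N ->
  mu [set g | same_at i j (color_word P g) && ~~ same_at i k (color_word P g)] =
  switch_prob P`_i P`_j P`_k.
Proof.
move=> iP jP kP; congr mu; apply/seteqP.
split=> g /=; rewrite /same_at !(nth_map 0) //.
  by case/andP=> /eqP/val_inj-> /eqP neq; split=> // eq; apply: neq; rewrite eq.
by case=> -> neq; rewrite eqxx; apply/eqP => /val_inj.
Qed.

(* The event is disjoint from "[O] agrees with [M]" and "[O] agrees with [C']",
   which are themselves disjoint, [M] being a unit neighbour of [C] and [C']. *)
Lemma spindle_switch (O M C C' : R[i]) e :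
  `|M - C| = 1 -> `|M - C'| = 1 -> `|O - M| = e%:C -> `|O - C'| = e%:C ->
  switch_prob O C C' <= 1 - 2 * p e.
Proof.
move=> MC MC' OM OC'.
have /(_ ltac:(by vm_compute)) := @color_word_weighted_le [:: O; C; C'; M]
  [:: (1, fun w => same_at 0 1 w && ~~ same_at 0 2 w); (1, same_at 0 2);
      (1, same_at 0 3)]%N
  [:: (1, xpredT); (1, same_at 3 1); (1, same_at 3 2)]%N.
rewrite !big_cons !big_nil /= switch_atE // !same_atE //= (prob_true muP).
rewrite (mono_probE c0 muP OM) (mono_probE c0 muP OC').
rewrite (mono_probE c0 muP MC) (mono_probE c0 muP MC') mono_prob1; lra.
Qed.

(** For [e >= 1/2] there is an isosceles triangle with base 1 and legs [e]. It is a spindle with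
    [C' = C], whose switch event has nonnegative probability. *)
Lemma mono_prob_le_half e : 1 / 2 <= e -> p e <= 1 / 2.
Proof.
move=> e_ge; pose k := Num.sqrt (e ^+ 2 - 1 / 4).
have kE : k ^+ 2 = e ^+ 2 - 1 / 4 by rewrite sqr_sqrtr //; nra.
pose M : R[i] := (1 / 2) +i* 0; pose C : R[i] := (- (1 / 2)) +i* 0.
pose O : R[i] := 0 +i* k.
have MC : `|M - C| = 1 by apply: (@normc_dist _ _ _ _ _ 1); lra.
have OM : `|O - M| = e%:C by apply: normc_dist; nra.
have OC : `|O - C| = e%:C by apply: normc_dist; nra.
have := spindle_switch MC MC OM OC.
have := prob_ge0 muP
  [set g | coloring_of c0 g O = coloring_of c0 g C
           /\ coloring_of c0 g O <> coloring_of c0 g C].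
rewrite -/(switch_prob O C C); lra.
Qed.

(* The expected number of monochromatic pairs among the five vertices of a
   path: it is 10 when all four edges are monochromatic, at least 1 by the
   pigeonhole principle, and the path rarely leaves these two extremes.
   The weights express [N >= 1 + 9 k / 4 - ...], where [k] is the number of
   monochromatic edges and [N] that of monochromatic pairs; each switch between
   consecutive edges is charged the deficit of the path with that switch only. *)
Lemma path_mono_pairs (A B C D E : R[i]) (q : R) :
  same_color_prob c0 mu A B = q -> same_color_prob c0 mu B C = q ->
  same_color_prob c0 mu C D = q -> same_color_prob c0 mu D E = q ->
  switch_prob B A C <= 1 - 2 * q -> switch_prob B C A <= 1 - 2 * q ->
  switch_prob C B D <= 1 - 2 * q -> switch_prob C D B <= 1 - 2 * q ->
  switch_prob D C E <= 1 - 2 * q -> switch_prob D E C <= 1 - 2 * q ->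
  31 * q <= 12 + same_color_prob c0 mu A C + same_color_prob c0 mu B D
            + same_color_prob c0 mu C E + same_color_prob c0 mu A D
            + same_color_prob c0 mu B E + same_color_prob c0 mu A E.
Proof.
move=> AB BC CD DE BAC BCA CBD CDB DCE DEC.
have /(_ ltac:(by vm_compute)) := @color_word_weighted_le [:: A; B; C; D; E]
  [:: (4, xpredT); (9, same_at 0 1); (9, same_at 1 2); (9, same_at 2 3);
      (9, same_at 3 4)]%N
  [:: (4, same_at 0 1); (4, same_at 1 2); (4, same_at 2 3); (4, same_at 3 4);
      (4, same_at 0 2); (4, same_at 1 3); (4, same_at 2 4);
      (4, same_at 0 3); (4, same_at 1 4); (4, same_at 0 4);
      (9, fun w => same_at 1 0 w && ~~ same_at 1 2 w);
      (7, fun w => same_at 1 2 w && ~~ same_at 1 0 w);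
      (10, fun w => same_at 2 1 w && ~~ same_at 2 3 w);
      (10, fun w => same_at 2 3 w && ~~ same_at 2 1 w);
      (7, fun w => same_at 3 2 w && ~~ same_at 3 4 w);
      (9, fun w => same_at 3 4 w && ~~ same_at 3 2 w)]%N.
rewrite !big_cons !big_nil /= !switch_atE // !same_atE //= (prob_true muP).
(* The switch weights add up to 52: with [S] the sum of the six other pairs,
   [4 + 36 q <= 16 q + 4 S + 52 (1 - 2 q)]. *)
rewrite AB BC CD DE; lra.
Qed.

(** Pigeonhole: four colours on five points. *)
Lemma five_points_mono (A B C D E : R[i]) :
  1 <= same_color_prob c0 mu A B + same_color_prob c0 mu A C
       + same_color_prob c0 mu A D + same_color_prob c0 mu A E
       + same_color_prob c0 mu B C + same_color_prob c0 mu B D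
       + same_color_prob c0 mu B E + same_color_prob c0 mu C D
       + same_color_prob c0 mu C E + same_color_prob c0 mu D E.
Proof.
have /(_ ltac:(by vm_compute)) := @color_word_weighted_le [:: A; B; C; D; E]
  [:: (1, xpredT)]%N
  [:: (1, same_at 0 1); (1, same_at 0 2); (1, same_at 0 3); (1, same_at 0 4);
      (1, same_at 1 2); (1, same_at 1 3); (1, same_at 1 4);
      (1, same_at 2 3); (1, same_at 2 4); (1, same_at 3 4)]%N.
rewrite !big_cons !big_nil /= !same_atE //= (prob_true muP); lra.
Qed.

(* The zigzag path with edges of length [e] whose vertices two steps apart are
   at distance [f]; the latter are both at distance 1 from a point at distance
   [e] from the vertex between them. *)
Lemma zigzag_mono (e f g : R) : 0 < e -> 0 <= f -> 0 <= g ->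
  f ^+ 2 = 4 - 1 / e ^+ 2 -> g ^+ 2 = e ^+ 2 + 2 * f ^+ 2 ->
  31 * p e <= 12 + 3 * p f + 2 * p g + p (2 * f).
Proof.
(* As [f ^ 2 / 4 + v ^ 2 = 1], the point [M] below is at distance 1 from [A] and [C]; as
   [2 e v = 1], the point [B], [e] above [M], is at distance [e] from both. *)
move=> e0 f0 g0 fE gE; pose v := 1 / (2 * e).
have ev : e * v = 1 / 2 by rewrite /v; field; lra.
have fv : f ^+ 2 = 4 - 4 * v ^+ 2.
  by rewrite fE /v; field; lra.
clear fE; pose A : R[i] := 0 +i* 0; pose B : R[i] := (f / 2) +i* (e - v).
pose C : R[i] := f +i* 0; pose D : R[i] := (3 * f / 2) +i* (e - v).
pose E : R[i] := (2 * f) +i* 0.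
pose M : R[i] := (f / 2) +i* (- v); pose N : R[i] := f +i* e.
pose K : R[i] := (3 * f / 2) +i* (- v).
have [[AB BC CD DE] [AC BD CE] [AD BE] AE] :
    [/\ [/\ `|A - B| = e%:C, `|B - C| = e%:C, `|C - D| = e%:C & `|D - E| = e%:C],
     [/\ `|A - C| = f%:C, `|B - D| = f%:C & `|C - E| = f%:C],
     `|A - D| = g%:C /\ `|B - E| = g%:C & `|A - E| = (2 * f)%:C].
  by split; do ?split; apply: normc_dist; lra.
have [[MA MC BM] [NB ND CN] [KC KE DK]] :
    [/\ [/\ `|M - A| = 1%:C, `|M - C| = 1%:C & `|B - M| = e%:C],
     [/\ `|N - B| = 1%:C, `|N - D| = 1%:C & `|C - N| = e%:C] &
     [/\ `|K - C| = 1%:C, `|K - E| = 1%:C & `|D - K| = e%:C]].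
  by split; split; apply: normc_dist; lra.
have [BA CB DC] : [/\ `|B - A| = e%:C, `|C - B| = e%:C & `|D - C| = e%:C].
  by split; rewrite distrC.
have := @path_mono_pairs A B C D E (p e) (mono_probE c0 muP AB)
  (mono_probE c0 muP BC) (mono_probE c0 muP CD) (mono_probE c0 muP DE)
  (spindle_switch MA MC BM BC) (spindle_switch MC MA BM BA)
  (spindle_switch NB ND CN CD) (spindle_switch ND NB CN CB)
  (spindle_switch KC KE DK DE) (spindle_switch KE KC DK DC).
rewrite (mono_probE c0 muP AC) (mono_probE c0 muP BD) (mono_probE c0 muP CE).
rewrite (mono_probE c0 muP AD) (mono_probE c0 muP BE) (mono_probE c0 muP AE).
lra.
Qed.

(** The distances [f], [g] and [2 f] of the zigzag are all at least [a], so [Q] bounds each of its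
    six other terms. *)
Lemma mono_prob_zigzag_le (a Q e : R) : 0 <= a ->
  (forall x, a <= x -> p x <= Q) -> a <= Num.sqrt (4 - 1 / e ^+ 2) -> 1 / 2 <= e ->
  31 * p e <= 12 + 6 * Q.
Proof.
move=> a0 pQ af e_ge; set f := Num.sqrt _ in af.
have fE : f ^+ 2 = 4 - 1 / e ^+ 2.
  rewrite sqr_sqrtr // subr_ge0 ler_pdivrMr; nra.
pose g := Num.sqrt (e ^+ 2 + 2 * f ^+ 2).
have gE : g ^+ 2 = e ^+ 2 + 2 * f ^+ 2 by rewrite sqr_sqrtr //; nra.
have f0 : 0 <= f := sqrtr_ge0 _; have g0 : 0 <= g := sqrtr_ge0 _.
have e0 : 0 < e by lra.
have fg : f <= g by nra.
have := zigzag_mono e0 f0 g0 fE gE.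
have := pQ f af; have := pQ g (le_trans af fg).
have : p (2 * f) <= Q by apply: pQ; lra.
lra.
Qed.

(** [4 / 15] is the value of [e ^ 2] at which [f = 1 / 2], so that [Q = 1 / 2] is available. *)
Lemma mono_prob_le_15_31 (e : R) : 4 / 15 <= e ^+ 2 -> 0 <= e -> p e <= 15 / 31.
Proof.
move=> e2 e0; have e_ge : 1 / 2 <= e by apply: le_of_sqr => //; lra.
have f_ge : 1 / 2 <= Num.sqrt (4 - 1 / e ^+ 2).
  apply: le_of_sqr (sqrtr_ge0 _) _; have V : 1 / e ^+ 2 <= 15 / 4.
    by rewrite ler_pdivrMr; lra.
  by rewrite sqr_sqrtr; lra.
have h0 : 0 <= 1 / 2 :> R by lra.
have := mono_prob_zigzag_le h0 mono_prob_le_half f_ge e_ge; lra.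
Qed.

(* [2 - sqrt 3] is a fixed point of the map [e ^ 2 |-> f ^ 2 = 4 - 1 / e ^ 2],
   so the supremum of [p] over such [e] bounds all terms of [zigzag_mono]. *)
Lemma mono_prob_le_12_25 (e : R) :
  2 - Num.sqrt 3 <= e ^+ 2 -> 0 <= e -> p e <= 12 / 25.
Proof.
set s : R := Num.sqrt 3; have s0 : 0 <= s := sqrtr_ge0 _.
have sE : s ^+ 2 = 3 by rewrite sqr_sqrtr.
have s_lt : s <= 7 / 4 by apply: le_of_sqr; lra.
pose a : R := Num.sqrt (2 - s); have a0 : 0 <= a := sqrtr_ge0 _.
have aE : a ^+ 2 = 2 - s by rewrite sqr_sqrtr; lra.
have a_half : 1 / 2 <= a by apply: le_of_sqr; lra.
move=> e2 e0; have ae : a <= e by apply: le_of_sqr; lra.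
pose S := [set p x | x in [set x | a <= x]].
have S_ub (x : R) : a <= x -> p x <= 1 / 2.
  by move=> ax; apply: mono_prob_le_half; apply: le_trans ax.
have S_has_sup : has_sup S.
  split; first by exists (p a), a => //=.
  by exists (1 / 2) => _ [x /= ax <-]; exact: S_ub.
have p_sup (x : R) : a <= x -> p x <= sup S.
  by move=> ax; apply: sup_ubound; [case: S_has_sup | exists x].
have p_le (x : R) : a <= x -> p x <= (12 + 6 * sup S) / 31.
  move=> ax; rewrite ler_pdivlMr; last lra.
  rewrite mulrC; apply: (mono_prob_zigzag_le a0 p_sup); last exact: le_trans ax.
  have x2 : 2 - s <= x ^+ 2 by rewrite -aE ler_sqr ?nnegrE // (le_trans a0).
  have V : 1 / x ^+ 2 <= 2 + s.
    have s2 : (2 + s) * (2 - s) = 1 by lra.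
    have x2_gt0 : 0 < x ^+ 2 by lra.
    have : (2 + s) * (2 - s) <= (2 + s) * x ^+ 2 by rewrite ler_pM2l //; lra.
    by rewrite s2 ler_pdivrMr.
  by apply: le_of_sqr (sqrtr_ge0 _) _; rewrite aE sqr_sqrtr; lra.
(* This self-improving bound reads [25 * sup S <= 12]. *)
have : sup S <= (12 + 6 * sup S) / 31.
  apply: ge_sup; first by case: S_has_sup.
  by move=> _ [x /= ax <-]; exact: p_le.
have := p_sup e ae; lra.
Qed.

(* Two equilateral triangles [A B C] and [A O O'] of sides 1 and [d] with
   [|O B| = |O' C| = d]: among these five points, two have the same colour, and
   the only distances other than 1 and [d] are [|O C|] and [|O' B|]. *)
Lemma double_triangle_mono (d h : R) : 0 <= d -> 0 <= h ->
  h ^+ 2 = d ^+ 2 - 1 / 4 ->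
  1 <= 5 * p d + p `|h - Num.sqrt 3 / 2| + p (h + Num.sqrt 3 / 2).
Proof.
set s := Num.sqrt 3; have s0 : 0 <= s := sqrtr_ge0 _.
have sE : s ^+ 2 = 3 by rewrite sqr_sqrtr.
move=> d0 h0 hE.
pose A : R[i] := (- (1 / 2)) +i* 0; pose B : R[i] := (1 / 2) +i* 0.
pose C : R[i] := 0 +i* (s / 2); pose O : R[i] := 0 +i* h.
(* The rotation by 60 degrees about [A] takes [B] to [C] and [O] to [O']. *)
pose O' : R[i] := (- (1 / 4) - s * h / 2) +i* (s / 4 + h / 2).
have AB : `|A - B| = 1%:C by apply: normc_dist; lra.
have AC : `|A - C| = 1%:C by apply: normc_dist; lra.
have BC : `|B - C| = 1%:C by apply: normc_dist; lra.
have AO : `|A - O| = d%:C by apply: normc_dist; lra.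
have BO : `|B - O| = d%:C by apply: normc_dist; lra.
have AO' : `|A - O'| = d%:C.
  apply: normc_dist => //; rewrite -[d ^+ 2](subrK (1 / 4)) -hE.
  by transitivity (s ^+ 2 * (h ^+ 2 / 4 + 1 / 16) + h ^+ 2 / 4 + 1 / 16);
    [field | rewrite sE; field].
have CO' : `|C - O'| = d%:C.
  apply: normc_dist => //; rewrite -[d ^+ 2](subrK (1 / 4)) -hE.
  by transitivity (s ^+ 2 * (h ^+ 2 / 4 + 1 / 16) + h ^+ 2 / 4 + 1 / 16);
    [field | rewrite sE; field].
have OO' : `|O - O'| = d%:C.
  apply: normc_dist => //; rewrite -[d ^+ 2](subrK (1 / 4)) -hE.
  by transitivity (s ^+ 2 * (h ^+ 2 / 4 + 1 / 16) + h ^+ 2 / 4 + 1 / 16);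
    [field | rewrite sE; field].
have CO : `|C - O| = `|h - s / 2|%:C.
  by apply: normc_dist => //; rewrite real_normK ?num_real //; ring.
have BO' : `|B - O'| = (h + s / 2)%:C.
  apply: normc_dist; first lra.
  transitivity (s ^+ 2 * (h ^+ 2 / 4 + 1 / 16) + h ^+ 2 / 4 + s * h + 9 / 16).
    by field.
  by transitivity (h ^+ 2 + s * h + s ^+ 2 / 4); [rewrite sE; field | field].
have := five_points_mono A B C O O'.
rewrite (mono_probE c0 muP AB) (mono_probE c0 muP AC) (mono_probE c0 muP BC).
rewrite (mono_probE c0 muP AO) (mono_probE c0 muP BO) (mono_probE c0 muP CO).
rewrite (mono_probE c0 muP AO') (mono_probE c0 muP BO') (mono_probE c0 muP CO').
rewrite (mono_probE c0 muP OO') mono_prob1; lra.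
Qed.

(** * Lower bounds on [p d] *)

Local Notation s3 := (Num.sqrt 3 : R).

(* [t] is a lower bound for the distance [|h - sqrt 3 / 2|] in
   [double_triangle_mono]. *)
Lemma mono_prob_ge (d t b : R) : 1 / 2 <= d -> 1 / 2 <= t <= s3 / 2 ->
  d ^+ 2 <= 1 / 4 + (s3 / 2 - t) ^+ 2 \/ 1 / 4 + (s3 / 2 + t) ^+ 2 <= d ^+ 2 ->
  (forall e, t <= e -> p e <= b) ->
  1 - b - 12 / 25 <= 5 * p d.
Proof.
have s0 : 0 <= s3 := sqrtr_ge0 _.
have sE : s3 ^+ 2 = 3 by rewrite sqr_sqrtr.
move=> d_ge /andP[t_ge t_le] d2 pb.
have d2_ge : (1 / 2) ^+ 2 <= d ^+ 2 by rewrite ler_sqr ?nnegrE; lra.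
pose h : R := Num.sqrt (d ^+ 2 - 1 / 4).
have h0 : 0 <= h := sqrtr_ge0 _.
have hE : h ^+ 2 = d ^+ 2 - 1 / 4 by rewrite sqr_sqrtr; lra.
have d0 : 0 <= d by lra.
have p5 := double_triangle_mono d0 h0 hE.
have p_plus : p (h + s3 / 2) <= 12 / 25.
  apply: mono_prob_le_12_25 => //; last lra.
  (* Here [(h + s3 / 2) ^ 2 >= 3 / 4 >= 2 - s3]. *)
  have s_ge : 5 / 4 <= s3 by apply: le_of_sqr; lra.
  have := mulr_ge0 h0 s0; have := sqr_ge0 h; lra.
have p_minus : p `|h - s3 / 2| <= b.
  apply: pb; rewrite ler_normr; apply/orP; case: d2 => d2; [right|left].
    have : h <= s3 / 2 - t by apply: le_of_sqr; lra.
    lra.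
  have : s3 / 2 + t <= h by apply: le_of_sqr; lra.
  lra.
lra.
Qed.

Lemma mono_prob_ge_near (d t b : R) :
  1 / 2 <= t <= s3 / 2 -> (forall e, t <= e -> p e <= b) ->
  1 / 2 <= d -> d <= Num.sqrt (1 / 4 + (s3 / 2 - t) ^+ 2) ->
  1 - b - 12 / 25 <= 5 * p d.
Proof.
move=> t_rng pb d_ge d_le; apply: (mono_prob_ge d_ge t_rng _ pb); left.
have d0 : 0 <= d by lra.
have y0 := sqr_ge0 (s3 / 2 - t).
by move: d_le; rewrite -[d <= _]ler_sqr ?nnegrE ?sqrtr_ge0 // sqr_sqrtr //; lra.
Qed.

Lemma mono_prob_ge_far (d t b : R) :
  1 / 2 <= t <= s3 / 2 -> (forall e, t <= e -> p e <= b) ->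
  Num.sqrt (1 / 4 + (s3 / 2 + t) ^+ 2) <= d ->
  1 - b - 12 / 25 <= 5 * p d.
Proof.
move=> t_rng pb d_ge; have d_ge_half := le_trans (half_le_sqrt _) d_ge.
apply: (mono_prob_ge d_ge_half t_rng _ pb); right.
have d0 : 0 <= d by lra.
have y0 := sqr_ge0 (s3 / 2 + t).
by move: d_ge; rewrite -[_ <= d]ler_sqr ?nnegrE ?sqrtr_ge0 // sqr_sqrtr //; lra.
Qed.

End ColoringProbabilities.

Theorem mainTheorem6 (R : realType) (c0 : R[i] -> 'I_4)
    (mu : set (colsym R) -> R)
    (c0_proper : proper_coloring c0) (mu_prob : left_invariant_prob mu)
    (d : R) :
  let p := mono_prob c0 mu in
  let sqrt := @Num.sqrt R in
  [/\ 1 / 2 <= d <= sqrt (1 / 2 * (2 - sqrt 2) * (3 - sqrt 3)) ->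
        1 / 150 <= p d,
      sqrt (1 / 2 * (2 - sqrt 2) * (3 - sqrt 3)) < d
        <= sqrt (19 / 15 - 2 / sqrt 5) ->
        14 / 2325 <= p d
    & sqrt (19 / 15 - 2 / sqrt 5) < d <= 1 / 2 * sqrt (5 - 2 * sqrt 3) ->
        1 / 300 <= p d]
  /\
  [/\ 1 / 2 * sqrt (5 + 2 * sqrt 3) <= d < sqrt (19 / 15 + 2 / sqrt 5) ->
        1 / 300 <= p d,
      sqrt (19 / 15 + 2 / sqrt 5) <= d
        < sqrt (1 / 2 * (2 + sqrt 2) * (3 - sqrt 3)) ->
        14 / 2325 <= p d
    & sqrt (1 / 2 * (2 + sqrt 2) * (3 - sqrt 3)) <= d ->
        1 / 150 <= p d].
Proof.
move=> p sqrt; rewrite /sqrt /p.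
set s2 : R := Num.sqrt 2; set s3 : R := Num.sqrt 3; set s5 : R := Num.sqrt 5.
have s2_0 : 0 <= s2 := sqrtr_ge0 _; have s3_0 : 0 <= s3 := sqrtr_ge0 _.
have s5_0 : 0 <= s5 := sqrtr_ge0 _.
have s2E : s2 ^+ 2 = 2 by rewrite sqr_sqrtr.
have s3E : s3 ^+ 2 = 3 by rewrite sqr_sqrtr.
have s5E : s5 ^+ 2 = 5 by rewrite sqr_sqrtr.
have [s3_ge s3_le] : 5 / 4 <= s3 /\ s3 <= 7 / 4.
  by split; apply: le_of_sqr; lra.
(* [2 - sqrt 3] and [4 / 15] are the values of [e ^ 2] at which the bounds
   12/25 and 15/31 on [p e] start to hold. *)
pose t1 : R := s2 * (s3 - 1) / 2; pose t2 : R := 2 * s3 * s5 / 15.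
have t1E : t1 ^+ 2 = 2 - s3.
  by transitivity (s2 ^+ 2 * (s3 ^+ 2 - 2 * s3 + 1) / 4);
    [rewrite /t1 | rewrite s2E s3E]; field.
have t2E : t2 ^+ 2 = 4 / 15.
  by transitivity (4 * s3 ^+ 2 * s5 ^+ 2 / 225);
    [rewrite /t2 | rewrite s3E s5E]; field.
have t1_0 : 0 <= t1 by rewrite divr_ge0 // mulr_ge0 //; lra.
have t2_0 : 0 <= t2 by rewrite divr_ge0 // !mulr_ge0.
have t1_rng : 1 / 2 <= t1 <= s3 / 2 by apply/andP; split; apply: le_of_sqr; lra.
have t2_rng : 1 / 2 <= t2 <= s3 / 2 by apply/andP; split; apply: le_of_sqr; lra.
have half_rng : (1 / 2 : R) <= 1 / 2 <= s3 / 2 by apply/andP; split; lra.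
have Vs5 : 2 / s5 = 2 * s5 / 5.
  have s5_neq0 : s5 != 0 by apply: contra_eq_neq s5E => ->; rewrite expr0n /=; lra.
  by rewrite -[X in _ = _ / X]s5E; field.
(* The thresholds on [d ^ 2] are [1 / 4 + (s3 / 2 - t) ^ 2] and [1 / 4 + (s3 / 2 + t) ^ 2] for [t]
   equal to [t1], [t2] and [1 / 2]. *)
have d1m : 1 / 4 + (s3 / 2 - t1) ^+ 2 = 1 / 2 * (2 - s2) * (3 - s3).
  transitivity (1 / 4 + s3 ^+ 2 / 4 - (s3 ^+ 2 - s3) * s2 / 2 + t1 ^+ 2).
    by rewrite /t1; field.
  by rewrite t1E s3E; field.
have d1p : 1 / 4 + (s3 / 2 + t1) ^+ 2 = 1 / 2 * (2 + s2) * (3 - s3).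
  transitivity (1 / 4 + s3 ^+ 2 / 4 + (s3 ^+ 2 - s3) * s2 / 2 + t1 ^+ 2).
    by rewrite /t1; field.
  by rewrite t1E s3E; field.
have d2m : 1 / 4 + (s3 / 2 - t2) ^+ 2 = 19 / 15 - 2 / s5.
  transitivity (1 / 4 + s3 ^+ 2 / 4 - s3 ^+ 2 * (2 * s5 / 15) + t2 ^+ 2).
    by rewrite /t2; field.
  by rewrite t2E s3E Vs5; field.
have d2p : 1 / 4 + (s3 / 2 + t2) ^+ 2 = 19 / 15 + 2 / s5.
  transitivity (1 / 4 + s3 ^+ 2 / 4 + s3 ^+ 2 * (2 * s5 / 15) + t2 ^+ 2).
    by rewrite /t2; field.
  by rewrite t2E s3E Vs5; field.
have [t1_ge t2_ge] : 1 / 2 <= t1 /\ 1 / 2 <= t2.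
  by case/andP: t1_rng; case/andP: t2_rng.
have pt1 e : t1 <= e -> p e <= 12 / 25.
  move=> t1e; apply: mono_prob_le_12_25 => //; last lra.
  by rewrite -t1E ler_sqr ?nnegrE; lra.
have pt2 e : t2 <= e -> p e <= 15 / 31.
  move=> t2e; apply: mono_prob_le_15_31 => //; last lra.
  by rewrite -t2E ler_sqr ?nnegrE; lra.
have phalf e : 1 / 2 <= e -> p e <= 1 / 2 by exact: mono_prob_le_half.
have d3m : 1 / 4 + (s3 / 2 - 1 / 2) ^+ 2 = (5 - 2 * s3) / 4 by lra.
have d3p : 1 / 4 + (s3 / 2 + 1 / 2) ^+ 2 = (5 + 2 * s3) / 4 by lra.
have half_le z : Num.sqrt (1 / 4 + z ^+ 2) < d -> 1 / 2 <= d.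
  by move=> /ltW; exact: le_trans (half_le_sqrt z).
have near t b := @mono_prob_ge_near _ _ _ c0_proper mu_prob d t b.
have far t b := @mono_prob_ge_far _ _ _ c0_proper mu_prob d t b.
rewrite -d1m -d1p -d2m -d2p !half_sqrt -?d3m -?d3p; try lra.
(* The bounds 12/25, 15/31 and 1/2 yield [p d] at least 1/125, 28/3875 and 1/250, which exceed the
   constants claimed. *)
split; split.
- by case/andP=> d_ge d_le; have := near _ _ t1_rng pt1 d_ge d_le; lra.
- by case/andP=> /half_le d_ge d_le; have := near _ _ t2_rng pt2 d_ge d_le; lra.
- case/andP=> /half_le d_ge d_le.
  by have := near _ _ half_rng phalf d_ge d_le; lra.
- by case/andP=> d_ge _; have := far _ _ half_rng phalf d_ge; lra.
- by case/andP=> d_ge _; have := far _ _ t2_rng pt2 d_ge; lra.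
- by move=> d_ge; have := far _ _ t1_rng pt1 d_ge; lra.
Qed.
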